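(* For every even $n\ge 4$, the $(1,3)$-biased Clique game on $K_n$ is won by player $2$.
   Context: Two players, Alice (player 1, starting) and Bob (player 2), alternately colour uncoloured edges of the complete graph $K_n$, Alice in red and Bob in blue. In the $(p,q)$-biased version Alice colours $p$ edges on each of her turns and Bob colours $q$ edges on each of his turns. In the Clique game, at the end Alice's score is $a=\omega(G[A])$ and Bob's score is $b=\omega(G[B])$, the clique numbers of the graphs formed by the red edges $A$ and the blue edges $B$. When $q>p$, Bob (player 2) wins if at the end $b>a$. Here $(p,q)=(1,3)$. *)

(* Defs.v *)
From mathcomp Require Import all_boot.

Set Implicit Arguments.
Unset Strict Implicit.
Unset Printing Implicit Defensive.

Section CliqueGame.

(* Player 1 (Alice, red) colours p edges per turn, player 2 (Bob, blue) q. *)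
Variables (p q n : nat).

(* A set of edges of K_n; an edge is a 2-element set of vertices. *)
Definition edge_set := {set {set 'I_n}}.

Definition edges : edge_set := [set e : {set 'I_n} | #|e| == 2].

(* Cliques of the subgraph induced by the edge set E: its vertices are the
   endpoints of the edges in E. *)
Definition is_clique (E : edge_set) (S : {set 'I_n}) : bool :=
  (S \subset cover E) &&
  [forall x in S, forall y in S, (x != y) ==> ([set x; y] \in E)].

Definition clique_number (E : edge_set) : nat :=
  \max_(S : {set 'I_n} | is_clique E S) #|S|.

(* A history lists the moves made so far, oldest first; each move is the set of
   edges coloured in one turn.  The moves of player 1 are those of even index. *)
Definition history := seq edge_set.

Definition red (h : history) : edge_set :=
  \bigcup_(i < size h | ~~ odd i) nth set0 h i.

Definition blue (h : history) : edge_set :=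
  \bigcup_(i < size h | odd i) nth set0 h i.

Definition uncoloured (h : history) : edge_set :=
  edges :\: (red h :|: blue h).

Definition game_over (h : history) : bool := uncoloured h == set0.

(* The player to move colours the prescribed number of edges, or all the
   remaining ones if there are fewer. *)
Definition legal_move (h : history) (M : edge_set) : bool :=
  (M \subset uncoloured h) &&
  (#|M| == minn (if odd (size h) then q else p) #|uncoloured h|).

Definition is_play (h : history) : Prop :=
  forall i, i < size h ->
    ~~ game_over (take i h) /\ legal_move (take i h) (nth set0 h i).

(* A strategy for player 2 prescribes a legal move whenever player 2 is to
   move; its values on other histories are irrelevant. *)
Definition player2_strategy (sigma : history -> edge_set) : Prop :=
  forall h, is_play h -> odd (size h) -> ~~ game_over h ->
    legal_move h (sigma h).

Definition follows (sigma : history -> edge_set) (h : history) : Prop :=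
  forall i, i < size h -> odd i -> nth set0 h i = sigma (take i h).

(* The winning condition is the one in force for q > p: player 2 must obtain a
   strictly larger clique number than player 1. *)
Definition clique_game_won_by_player2 : Prop :=
  exists sigma : history -> edge_set,
    player2_strategy sigma /\
    forall h, is_play h -> follows sigma h -> game_over h ->
      clique_number (red h) < clique_number (blue h).

End CliqueGame.

(* Main.v *)
(* After the first red edge {a, b}, player 2 fixes a fixed-point-free involution s
   of the vertices with s a = b and a vertex u other than a and b, and colours
   {u, s u}, {u, a} and {u, b}.  From then on player 2 answers each red edge by
   colouring all the uncoloured edges in conflict with it, of which there are at
   most three: {x, y} is in conflict with {s x, s y}, with {x, s y} unless y is u
   or s u, and {u, x} is in conflict with {x, s x}.  At the end no two red edges
   are in conflict.  Let S be a red clique avoiding u and s u and containing no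
   matched pair {x, s x}.  Its mirror image is a blue clique, which can be
   enlarged by any x in S with {x, s x} blue; if there is none, all edges from u
   to the mirror image are blue and it can be enlarged by u.  If S contains u or
   s u, the mirror image of the rest of S can be enlarged by both u and s u. *)

Require Import Defs.
From mathcomp Require Import all_boot.
From mathcomp Require Import perm.

Set Implicit Arguments.
Unset Strict Implicit.
Unset Printing Implicit Defensive.

(** * Facts on finite sets *)

Lemma set2_eq_cases (T : finType) (a b c d : T) :
  [set a; b] = [set c; d] -> (a = c /\ b = d) \/ (a = d /\ b = c).
Proof.
move=> E.
have : a \in [set c; d] by rewrite -E set21.
have : b \in [set c; d] by rewrite -E set22.
have : c \in [set a; b] by rewrite E set21.
have : d \in [set a; b] by rewrite E set22.
rewrite !inE.
case/orP=> /eqP Ed; case/orP=> /eqP Ec; case/orP=> /eqP Eb; case/orP=> /eqP Ea;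
  subst; by [left | right].
Qed.

(** Pads the at most three forced answers of player 2 to a move of exactly the prescribed size. *)
Lemma exists_set_between (T : finType) (D A : {set T}) k :
  D \subset A -> #|D| <= k <= #|A| ->
  exists2 B : {set T}, D \subset B /\ B \subset A & #|B| = k.
Proof.
move=> sDA /andP[leDk]; elim: k leDk => [|k IH].
  by rewrite leqn0 => /eqP D0 _; exists D.
rewrite leq_eqVlt => /orP[/eqP<- _|leDk ltkA]; first by exists D.
have [B [sDB sBA] cB] := IH leDk (ltnW ltkA).
have : B \proper A by rewrite properEcard sBA cB.
case/properP=> _ [x xA xB]; exists (x |: B).
  by split; [apply: subset_trans sDB (subsetUr _ _) | rewrite subUset sub1set xA].
by rewrite cardsU1 xB cB.
Qed.

(** * Histories of play, and strategies obtained from invariants *)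

Section Histories.

Variables p q n : nat.
Implicit Types (h : history n) (M B R U : edge_set n).

Lemma red_rcons h M :
  red (rcons h M) = if odd (size h) then red h else red h :|: M.
Proof.
rewrite /red size_rcons [LHS]big_mkcond big_ord_recr /= -big_mkcond /=.
rewrite nth_rcons ltnn eqxx.
have -> : \bigcup_(i < size h | ~~ odd i) nth set0 (rcons h M) i =
          \bigcup_(i < size h | ~~ odd i) nth set0 h i.
  by apply: eq_bigr => i _; rewrite nth_rcons ltn_ord.
by case: odd => //=; rewrite setU0.
Qed.

Lemma blue_rcons h M :
  blue (rcons h M) = if odd (size h) then blue h :|: M else blue h.
Proof.
rewrite /blue size_rcons [LHS]big_mkcond big_ord_recr /= -big_mkcond /=.
rewrite nth_rcons ltnn eqxx.
have -> : \bigcup_(i < size h | odd i) nth set0 (rcons h M) i =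
          \bigcup_(i < size h | odd i) nth set0 h i.
  by apply: eq_bigr => i _; rewrite nth_rcons ltn_ord.
by case: odd => //=; rewrite setU0.
Qed.

Lemma uncoloured_rcons h M : uncoloured (rcons h M) = uncoloured h :\: M.
Proof.
rewrite /uncoloured red_rcons blue_rcons setDDl.
by case: odd; rewrite ?setUA // setUAC.
Qed.

Lemma is_play_rcons h M :
  is_play p q (rcons h M) ->
  [/\ is_play p q h, ~~ game_over h & legal_move p q h M].
Proof.
move=> P; split.
- move=> i ih; have := P i; rewrite size_rcons ltnS nth_rcons ih => /(_ (ltnW ih)).
  by rewrite -cats1 takel_cat // ltnW.
- have [] := P (size h); first by rewrite size_rcons.
  by rewrite -cats1 take_size_cat.
have [] := P (size h); first by rewrite size_rcons.
by rewrite -cats1 take_size_cat // nth_cat ltnn subnn.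
Qed.

Lemma follows_rcons (sigma : history n -> edge_set n) h M :
  follows sigma (rcons h M) ->
  follows sigma h /\ (odd (size h) -> M = sigma h).
Proof.
move=> F; split=> [i ih oi|oh].
  have := F i; rewrite size_rcons ltnS nth_rcons ih => /(_ (ltnW ih) oi) ->.
  by rewrite -cats1 takel_cat // ltnW.
have := F (size h); rewrite size_rcons => /(_ (leqnn _) oh).
by rewrite -cats1 take_size_cat // nth_cat ltnn subnn.
Qed.

(** Every move is drawn from the uncoloured edges, so blue stays disjoint from red. Hence an
    invariant need only track the red and the uncoloured edges. *)
Lemma blue_at_end h :
  is_play p q h -> game_over h -> blue h = edges n :\: red h.
Proof.
move=> P /eqP U0.
have {P} [bE dis] : blue h \subset edges n /\ [disjoint blue h & red h].
  elim/last_ind: h P {U0} => [_|h M IH /is_play_rcons[/IH[bE dis] _]].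
    by rewrite /blue /red !big_ord0 sub0set disjoints_subset sub0set.
  case/andP=> sM _; rewrite red_rcons blue_rcons.
  move: sM; rewrite /uncoloured subsetD => /andP[ME].
  rewrite -setI_eq0 setIUr setU_eq0 !setI_eq0 => /andP[Mr Mb].
  case: odd; rewrite ?subUset ?bE ?ME; split=> //.
    by rewrite -setI_eq0 setIUl setU_eq0 !setI_eq0 dis.
  by rewrite -setI_eq0 setIUr setU_eq0 !setI_eq0 dis disjoint_sym.
apply/setP=> e; rewrite inE; have := in_set0 e; rewrite -U0 !inE.
case rb: (e \in blue h) => /=.
  by have := subsetP bE e rb; rewrite (disjointFr dis rb) inE => ->.
by rewrite orbF => ->.
Qed.

(** [I] is to hold whenever player 1 is to move; the strategy picks any legal reply that restores
    it. *)
Lemma player2_wins_by_invariant (I : edge_set n -> edge_set n -> bool) :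
  I set0 (edges n) ->
  (forall R U M, U \subset edges n -> I R U ->
     M \subset U -> #|M| = minn p #|U| ->
     exists B, [/\ B \subset U :\: M, #|B| = minn q #|U :\: M|
                 & I (R :|: M) (U :\: M :\: B)]) ->
  (forall R, I R set0 -> clique_number R < clique_number (edges n :\: R)) ->
  clique_game_won_by_player2 p q n.
Proof.
move=> I0 Istep Iend.
pose good h B := legal_move p q h B && I (red h) (uncoloured h :\: B).
(* Legality is demanded on every play, even off the strategy, hence the fallback to an arbitrary
   legal move. The default [set0] is never reached, since a legal move exists. *)
pose sigma h :=
  odflt (odflt set0 [pick B | legal_move p q h B]) [pick B | good h B].
have good_sigma h B : good h B -> good h (sigma h).
  rewrite /sigma; case: (pickP [pred C | good h C]) => [C|none] //=.
  by have /= -> := none B.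
(* When player 2 is to move, the induction carries the existence of a good reply in place of [I]. *)
have inv h : is_play p q h -> follows sigma h ->
  if odd (size h) then exists B, good h B else I (red h) (uncoloured h).
  elim/last_ind: h => [_ _|h M IH].
    by rewrite /uncoloured /red /blue !big_ord0 setU0 setD0.
  case/is_play_rcons=> P _ /andP[sM /eqP cM] /follows_rcons[F Mdef].
  move: (IH P F) Mdef; rewrite size_rcons /= uncoloured_rcons red_rcons.
  case oh: odd cM => cM Ih Mdef /=.
    by rewrite Mdef //; have [B /good_sigma/andP[]] := Ih.
  have [|B [sB cB IB]] := Istep _ _ M _ Ih sM cM; first exact: subsetDl.
  exists B; rewrite /good /legal_move size_rcons /= oh uncoloured_rcons sB cB.
  by rewrite eqxx red_rcons oh.
exists sigma; split=> [h P oh _|h P F over].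
  case: (pickP (good h)) => [B /good_sigma/andP[] //|none].
  rewrite /sigma; case: (pickP [pred C | good h C]) => [C|_ /=].
    by rewrite inE none.
  case: pickP => //= nolegal.
  have [|B [_ sB] cB] :=
      @exists_set_between _ set0 (uncoloured h) (minn q #|uncoloured h|) (sub0set _).
    by rewrite cards0 geq_minr.
  by have := nolegal B; rewrite /legal_move sB oh cB eqxx.
rewrite (blue_at_end P over); apply: Iend.
move: (inv h P F); rewrite /good (eqP over); case: odd => // -[B].
by rewrite set0D => /andP[].
Qed.

End Histories.

(** A clique must lie in the cover of its edge set; a second vertex of [S] provides an edge at each
    vertex. *)
Lemma blue_clique_bound n (R : edge_set n) (S : {set 'I_n}) :
  1 < #|S| ->
  (forall x y, x \in S -> y \in S -> x != y -> [set x; y] \notin R) ->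
  #|S| <= clique_number (edges n :\: R).
Proof.
move=> S2 SR.
have SE x y : x \in S -> y \in S -> x != y -> [set x; y] \in edges n :\: R.
  by move=> xS yS xy; rewrite !inE SR // cards2 xy.
rewrite /clique_number.
apply: (@leq_bigmax_cond _ (is_clique (edges n :\: R)) (fun S => #|S|) S).
apply/andP; split.
  apply/subsetP=> x xS; have : 0 < #|S :\ x| by move: S2; rewrite (cardsD1 x) xS.
  case/card_gt0P=> y; rewrite !inE => /andP[yx yS].
  apply/bigcupP; exists [set x; y]; last exact: set21.
  by apply: SE; rewrite // eq_sym.
apply/forall_inP=> x xS; apply/forall_inP=> y yS; apply/implyP=> xy.
exact: SE.
Qed.

(** * Conflicts between edges, at most three for each edge *)

Section Conflicts.

Variables (n : nat) (s : 'I_n -> 'I_n) (u : 'I_n).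
Hypotheses (sK : involutive s) (s_neq : forall x, s x != x).
Implicit Types (e f : {set 'I_n}) (R : edge_set n).

(** Since [a] and [b] may be exchanged, the exemption of [u] and [s u] concerns only the endpoint
    that is replaced by its mirror image. *)
Definition cross e f := [exists a, exists b,
  [&& b != a, b != s a, e == [set a; b] &
    (f == [set s a; s b]) || (b \notin [set u; s u]) && (f == [set a; s b])]].

Definition spoke e f :=
  [exists b, [&& b \notin [set u; s u], e == [set u; b] & f == [set b; s b]]].

(* Pairs of edges that player 2 never lets player 1 own together.  An edge is in
   conflict with at most three others because the special vertices u and s u are
   treated asymmetrically: [set u; b] and [set s u; b] are not in conflict. *)
Definition conflict e f := [|| cross e f, spoke e f | spoke f e].

Lemma crossP e f : reflect
  (exists a b, [/\ b != a, b != s a, e = [set a; b] &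
     f = [set s a; s b] \/ b \notin [set u; s u] /\ f = [set a; s b]])
  (cross e f).
Proof.
apply: (iffP existsP) => [[a /existsP[b /and4P[? ? /eqP-> H]]]|[a [b [ba bsa -> H]]]].
  by exists a, b; split=> //; case/orP: H => [/eqP|/andP[? /eqP]]; auto.
exists a; apply/existsP; exists b; rewrite ba bsa eqxx /=.
by case: H => [->|[-> ->]]; rewrite eqxx ?orbT.
Qed.

Lemma spokeP e f : reflect
  (exists b, [/\ b \notin [set u; s u], e = [set u; b] & f = [set b; s b]])
  (spoke e f).
Proof.
apply: (iffP existsP) => -[b]; first by case/and3P=> ? /eqP-> /eqP->; exists b.
by case=> bu -> ->; exists b; rewrite bu !eqxx.
Qed.

Lemma s_eqC x y : (s x == y) = (x == s y).
Proof. by rewrite (can2_eq sK sK). Qed.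

Lemma s_special b : (s b \in [set u; s u]) = (b \in [set u; s u]).
Proof. by rewrite !inE s_eqC (inj_eq (can_inj sK)) orbC. Qed.

Lemma cross_sym e f : cross e f -> cross f e.
Proof.
case/crossP=> a [b [ba bsa -> H]]; apply/crossP.
case: H => [->|[bu ->]].
  by exists (s a), (s b); rewrite !(inj_eq (can_inj sK)) !sK; split; auto.
by exists a, (s b); rewrite s_special sK s_eqC (inj_eq (can_inj sK)); split; auto.
Qed.

Lemma conflict_sym e f : conflict e f -> conflict f e.
Proof.
by rewrite /conflict => /or3P[/cross_sym->|->|->]; rewrite ?orbT.
Qed.

Lemma spoke_irr e : ~~ spoke e e.
Proof.
apply/spokeP=> -[b [bu -> /set2_eq_cases]]; move: bu; rewrite !inE negb_or.
case/andP=> /eqP bu /eqP bsu [[ub _]|[ub _]]; first by apply: bu.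
by apply: bsu; rewrite ub sK.
Qed.

Lemma conflict_irr e : ~~ conflict e e.
Proof.
rewrite /conflict !negb_or spoke_irr !andbT.
apply/crossP=> -[a [b [ba bsa -> H]]].
case: H => [|[_]] /set2_eq_cases[] [].
- by move=> Ea; have := s_neq a; rewrite -Ea eqxx.
- by move=> _ Eb; rewrite Eb eqxx in bsa.
- by move=> _ Eb; have := s_neq b; rewrite -Eb eqxx.
by move=> Ea; rewrite Ea sK in bsa ba *; move: bsa; rewrite eqxx.
Qed.

(** [cross] excludes matched pairs, so only spokes remain. *)
Lemma conflict_matched a f :
  conflict [set a; s a] f -> f \in [set [set u; a]; [set u; s a]].
Proof.
case/or3P.
- case/crossP=> c [d [dc dsc /set2_eq_cases[][? ?] _]]; subst.
    by rewrite eqxx in dsc.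
  by rewrite sK eqxx in dsc.
- case/spokeP=> b [bu /set2_eq_cases[][E1 E2] _]; move: bu; rewrite !inE.
    by rewrite -E2 E1 eqxx orbT.
  by rewrite -E2 sK E1 eqxx orbT.
case/spokeP=> b [bu -> /set2_eq_cases[][-> E]]; first by rewrite set21.
by rewrite sK set22.
Qed.

(** A special endpoint is never replaced alone by its mirror image; the slot this frees holds the
    matched edge at the other endpoint, which a spoke conflict may require. *)
Lemma conflict_unmatched a b f : b != a -> b != s a ->
  conflict [set a; b] f ->
  f \in [set [set s a; s b];
    (if b \in [set u; s u] then [set s a; a] else [set a; s b]);
    (if a \in [set u; s u] then [set s b; b] else [set s a; b])].
Proof.
move=> ba bsa.
case/or3P.
- case/crossP=> c [d [_ _ /set2_eq_cases[][<- <-] [->|[H ->]]]].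
  + by rewrite !inE eqxx.
  + by rewrite (negPf H) !inE eqxx ?orbT.
  + by rewrite setUC !inE eqxx.
  by rewrite (negPf H) setUC !inE eqxx ?orbT.
- case/spokeP=> d [_ /set2_eq_cases[][E <-] ->]; rewrite E.
    by rewrite set21 setUC !inE eqxx ?orbT.
  by rewrite set21 setUC !inE eqxx ?orbT.
case/spokeP=> d [_ _ /set2_eq_cases[][E1 E2]]; move: bsa.
  by rewrite E2 E1 eqxx.
by rewrite E1 E2 sK eqxx.
Qed.

Lemma conflict_degree a b : b != a ->
  exists2 B : edge_set n, #|B| <= 3 & forall f, conflict [set a; b] f -> f \in B.
Proof.
have c3 (x y z : {set 'I_n}) : #|[set x; y; z]| <= 3.
  by rewrite (leq_trans (leq_card_setU _ _)) // cards1 cards2; case: eqP.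
move=> ba; case: (eqVneq b (s a)) => [->|bsa].
  exists [set [set u; a]; [set u; s a]]; last exact: conflict_matched.
  by rewrite cards2; case: eqP.
by eexists; last (by move=> f; exact: conflict_unmatched ba bsa); exact: c3.
Qed.

(** * Red and blue cliques when no two red edges are in conflict *)

Hypotheses (R : edge_set n) (uvR : [set u; s u] \notin R)
  (indep : forall e f, e \in R -> f \in R -> ~~ conflict e f).

Let red_opp a b : b != a -> b != s a -> [set a; b] \in R -> [set s a; s b] \notin R.
Proof.
move=> ba bsa abR; apply: contraL abR => /indep H; apply/negP=> /H.
apply/negP; rewrite negbK; apply: conflict_sym.
by apply/or3P/Or31/crossP; exists a, b; split; auto.
Qed.

Let red_side a b : b != a -> b != s a -> b \notin [set u; s u] ->
  [set a; b] \in R -> [set a; s b] \notin R.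
Proof.
move=> ba bsa bu abR; apply: contraL abR => /indep H; apply/negP=> /H.
apply/negP; rewrite negbK; apply: conflict_sym.
by apply/or3P/Or31/crossP; exists a, b; split; auto.
Qed.

Let red_spoke b : b \notin [set u; s u] -> [set b; s b] \in R -> [set u; b] \notin R.
Proof.
move=> bu bR; apply: contraL bR => /indep H; apply/negP=> /H.
by apply/negP; rewrite negbK; apply/or3P/Or32/spokeP; exists b.
Qed.

Lemma unmatched_special w x :
  w \in [set u; s u] -> x \notin [set u; s u] -> x != w /\ x != s w.
Proof.
move=> wu xu; split; apply: contraNneq xu => -> //.
by rewrite s_special.
Qed.

(** Either [w' = w], and only the ordinary endpoint [x] is reflected, or [w' = s w], and the whole
    edge is reflected. *)
Lemma special_red w x : w \in [set u; s u] -> x \notin [set u; s u] ->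
  [set w; x] \in R -> forall w', w' \in [set u; s u] -> [set w'; s x] \notin R.
Proof.
move=> wu xu wxR w' w'u; have [xw xsw] := unmatched_special wu xu.
have [->|->] : w' = w \/ w' = s w.
  by move: wu w'u; rewrite !inE => /orP[]/eqP-> /orP[]/eqP->; rewrite ?sK; auto.
- exact: red_side.
exact: red_opp.
Qed.

Let blue_clique (A : {set 'I_n}) :=
  forall x y, x \in A -> y \in A -> x != y -> [set x; y] \notin R.

Let blue_clique1U x A : blue_clique A ->
  (forall y, y \in A -> x != y -> [set x; y] \notin R) -> blue_clique (x |: A).
Proof.
move=> bA bx y z; rewrite !inE => /orP[/eqP->|yA] /orP[/eqP->|zA].
- by rewrite eqxx.
- exact: bx.
- by rewrite eq_sym setUC; apply: bx.
exact: bA.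
Qed.

Let blue_clique1 x : blue_clique [set x].
Proof. by move=> y z; rewrite !inE => /eqP-> /eqP->; rewrite eqxx. Qed.

Let blue_uv : blue_clique [set u; s u].
Proof.
by apply: blue_clique1U => // y; rewrite inE => /eqP->.
Qed.

(* Start from the blue clique s @: (S \ {u, s u}) and add u and s u if S contains
   one of them; otherwise add some x in S with [set x; s x] blue, or u if there
   is no such x. *)
Lemma red_clique_beaten (S : {set 'I_n}) :
  (forall x y, x \in S -> y \in S -> x != y -> [set x; y] \in R) ->
  exists B : {set 'I_n}, [/\ #|S| < #|B|, 1 < #|B| & blue_clique B].
Proof.
move=> redS; have uv2 : #|[set u; s u]| = 2 by rewrite cards2 eq_sym s_neq.
case: (pickP (fun x => (x \in S) && (s x \in S))) => [x /andP[xS sxS]|nomatch].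
  have xsx : [set x; s x] \in R by apply: redS; rewrite // eq_sym.
  have xu : x \notin [set u; s u].
    apply: contraL xsx; rewrite !inE => /orP[]/eqP-> //.
    by rewrite sK setUC.
  (* A third vertex [y] would have red edges to both [x] and [s x]; these are in conflict, as [x] is
     not special. *)
  have subS : S \subset [set x; s x].
    apply/subsetP=> y yS; apply: contraT; rewrite !inE negb_or => /andP[yx ysx].
    have xy : x != y by rewrite eq_sym.
    have xsy : x != s y by rewrite -s_eqC eq_sym.
    have /negP[] := red_side xy xsy xu (redS _ _ yS xS yx).
    exact: redS.
  (* The edges from [s u] to [x] and to [s x] are not both red, so [z] can be chosen with a blue
     edge to [s u]. Its edge to [u] is blue because the matched edge is red, which gives a blue
     triangle. *)
  pose z := if [set s u; x] \in R then s x else x.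
  have zu : z \notin [set u; s u] by rewrite /z; case: ifP => // _; rewrite s_special.
  have zz : [set z; s z] \in R by rewrite /z; case: ifP => // _; rewrite sK setUC.
  have suz : [set s u; z] \notin R.
    rewrite /z; case: ifP => [suxR|/negbT //].
    by apply: (special_red _ xu suxR); rewrite set22.
  exists (z |: [set u; s u]); rewrite cardsU1 zu uv2; split=> //.
    by rewrite (leq_ltn_trans (subset_leq_card subS)) // cards2; case: eqP.
  apply: blue_clique1U => // y; rewrite !inE setUC => /orP[]/eqP-> // _.
  exact: red_spoke.
pose T := S :\: [set u; s u].
have inT x : x \in T -> x \in S /\ x \notin [set u; s u] by case/setDP.
have bT : blue_clique (s @: T).
  move=> _ _ /imsetP[a /inT[aS _] ->] /imsetP[b /inT[bS _] ->].
  rewrite (inj_eq (can_inj sK)) => ab; apply: red_opp; first by rewrite eq_sym.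
    by apply: contraFneq (nomatch a) => <-; rewrite aS bS.
  exact: redS.
have cT : #|s @: T| = #|T| by rewrite card_imset //; exact: can_inj sK.
have T'u y : y \in s @: T -> y \notin [set u; s u].
  by case/imsetP=> a /inT[_ au] ->; rewrite s_special.
case: (pickP (fun w => (w \in S) && (w \in [set u; s u]))) => [w /andP[wS wu]|nouv].
  have bl w' : w' \in [set u; s u] -> forall y, y \in s @: T -> [set w'; y] \notin R.
    move=> w'u _ /imsetP[a /inT[aS au] ->]; apply: (special_red wu au) => //.
    by apply: redS; rewrite //; apply: contraNneq au => <-.
  (* Without matched pairs [S] has only one of [u] and [s u], so [T] loses one vertex while its
     mirror image gains two. *)
  have cS : #|S| <= #|T|.+1.
    have -> : #|T|.+1 = #|w |: T| by rewrite cardsU1 !inE -in_set2 wu.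
    apply/subset_leq_card/subsetP=> x xS; rewrite in_setU1.
    case: eqVneq => //= xw; rewrite inE xS andbT; apply/negP=> xu.
    have xE : x = s w.
      move: xu wu xw; rewrite !inE => /orP[]/eqP-> /orP[]/eqP->;
        by rewrite ?eqxx ?sK.
    by move: (nomatch w); rewrite wS -xE xS.
  exists (u |: (s u |: s @: T)).
  have c2 : #|u |: (s u |: s @: T)| = #|T|.+2.
    rewrite !cardsU1 cT !inE negb_or eq_sym s_neq /=.
    have /(contraL (T'u u)) -> : u \in [set u; s u] by rewrite set21.
    by have /(contraL (T'u (s u))) -> : s u \in [set u; s u] by rewrite set22.
  rewrite c2; split=> //; apply: blue_clique1U.
    by apply: blue_clique1U => // y yT _; apply: bl; rewrite ?set22.
  move=> y; rewrite in_setU1 => /orP[/eqP-> //|yT] _.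
  by apply: bl; rewrite ?set21.
have TS : T = S.
  apply/setP=> x; rewrite inE; case xS: (x \in S); rewrite ?andbF ?andbT //.
  by move: (nouv x); rewrite xS /= => ->.
rewrite TS in inT bT cT T'u.
(* For nonempty [S] one extra vertex already gives a blue set of size at least two; the empty clique
   needs its own witness. *)
case: (set_0Vmem S) => [->|[x0 x0S]].
  by exists [set u; s u]; rewrite cards0 uv2; split.
have c0 : 0 < #|S| by apply/card_gt0P; exists x0.
case: (pickP (fun x => (x \in S) && ([set x; s x] \notin R))) => [x /andP[xS xx]|allred].
  exists (x |: s @: S); have xT : x \notin s @: S.
    by apply/imsetP=> -[y yS xE]; move: (nomatch y); rewrite yS -xE xS.
  rewrite cardsU1 xT cT; split=> //; apply: blue_clique1U => // _ /imsetP[y yS ->] _.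
  case: (eqVneq y x) => [-> //|yx]; apply: red_side => //.
  - by apply: contraFneq (nomatch x) => <-; rewrite xS yS.
  - by case: (inT y yS).
  by apply: redS; rewrite // eq_sym.
exists (u |: s @: S); have uT : u \notin s @: S.
  by apply: (contraL (T'u u)); rewrite set21.
rewrite cardsU1 uT cT; split=> //; apply: blue_clique1U => // _ /imsetP[y yS ->] _.
apply: red_spoke; first by rewrite s_special; case: (inT y yS).
by rewrite sK setUC; move: (allred y); rewrite yS => /negbFE.
Qed.

Lemma clique_number_conflict_free :
  clique_number R < clique_number (edges n :\: R).
Proof.
(* The empty set is a clique, so the maximum is attained. *)
have cl0 : 0 < #|[pred S | is_clique R S]|.
  apply/card_gt0P; exists set0; rewrite inE /is_clique sub0set /=.
  by apply/forall_inP=> x; rewrite inE.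
have [S /andP[_ /forall_inP redS] maxS] := eq_bigmax_cond (fun S : {set 'I_n} => #|S|) cl0.
have [|B [ltSB B1 bB]] := @red_clique_beaten S.
  by move=> x y xS yS xy; have /forall_inP/(_ y yS)/implyP/(_ xy) := redS x xS.
by rewrite /clique_number maxS; apply: leq_trans ltSB (blue_clique_bound B1 bB).
Qed.

End Conflicts.

(* Conjugate the reversal i |-> n - 1 - i, which has no fixed point because n is
   even. *)
Lemma exists_involution n (a b : 'I_n) : ~~ odd n -> a != b ->
  exists s : {ffun 'I_n -> 'I_n}, [/\ involutive s, forall x, s x != x & s a = b].
Proof.
move=> evn ab.
have rev_neq (x : 'I_n) : rev_ord x != x.
  apply/negP=> /eqP/(congr1 val)/= E; move: evn.
  by rewrite -(subnKC (ltn_ord x)) E addSn /= addnn odd_double.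
(* [t] fixes [a], which differs from [b] and from its reversal, and sends [rev_ord a] to [b]; so the
   conjugate maps [a] to [b]. *)
pose t := tperm b (rev_ord a); exists [ffun x => t (rev_ord (t x))]; split.
- by move=> x; rewrite !ffunE tpermK rev_ordK tpermK.
- move=> x; rewrite ffunE; apply/eqP=> /(congr1 t); rewrite tpermK.
  by apply/eqP; exact: rev_neq.
by rewrite ffunE [t a]tpermD ?rev_neq // 1?eq_sym // tpermR.
Qed.

(** * The invariant and how player 2 maintains it *)

Section Invariant.

Variable n : nat.
Implicit Types (R U : edge_set n).

(** Letting [f] range over [R :|: U] says that every edge in conflict with a red one is already
    blue. *)
Definition safe (s : {ffun 'I_n -> 'I_n}) (u : 'I_n) R U :=
  [&& [forall x, s (s x) == x], [forall x, s x != x],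
      [set u; s u] \notin R :|: U &
      [forall e in R, forall f in R :|: U, ~~ conflict s u e f]].

Lemma safeP (s : {ffun 'I_n -> 'I_n}) u R U : reflect
  [/\ involutive s, forall x, s x != x, [set u; s u] \notin R :|: U &
      forall e f, e \in R -> f \in R :|: U -> ~~ conflict s u e f]
  (safe s u R U).
Proof.
apply: (iffP and4P) => -[H1 H2 H3 H4]; split=> //.
- by move=> x; apply/eqP/(forallP H1).
- exact/forallP.
- by move=> e f eR; move/forall_inP: H4 => /(_ e eR)/forall_inP; apply.
- by apply/forallP=> x; apply/eqP.
- exact/forallP.
by apply/forall_inP=> e eR; apply/forall_inP=> f; exact: H4.
Qed.

(** The new red edge [e] was uncoloured, so it conflicts with no older red edge; only its own
    conflicts, collected in [D], have to be answered. *)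
Lemma safe_step s u R U (e : {set 'I_n}) : safe s u R U -> e \in U -> #|e| = 2 ->
  exists2 D : edge_set n, #|D| <= 3 &
    forall B : edge_set n, D :&: (U :\ e) \subset B -> safe s u (e |: R) (U :\ e :\: B).
Proof.
case/safeP=> sK sn uv indep eU /eqP/cards2P[a [b [ab eE]]].
have [|D D3 De] := @conflict_degree n s u sK a b; first by rewrite eq_sym.
rewrite -eE in De; exists D => // B /subsetP sB.
have sub f : f \in e |: R :|: U :\ e :\: B -> f \in R :|: U.
  rewrite !inE; case: (eqVneq f e) => [->|_]; first by rewrite eU orbT.
  by case: (f \in R) => //= /andP[_ ->].
apply/safeP; split=> //; first by apply: contra uv; exact: sub.
move=> e' f; rewrite in_setU1 => /orP[/eqP-> fRU|e'R /sub]; last exact: indep.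
move: fRU; rewrite !inE => /orP[/orP[/eqP->|fR]|/andP[fB /andP[fe fU]]].
- exact: conflict_irr.
- apply: contra (indep f e fR _); first exact: conflict_sym.
  by rewrite inE eU orbT.
apply: contra fB => /De fD; apply: sB; rewrite !inE fD fe; exact: fU.
Qed.

(** Choosing [s] so that the first red edge is matched leaves it only two conflicts; the third blue
    edge is then free for [[set u; s u]]. *)
Lemma safe_first (e : {set 'I_n}) : 4 <= n -> ~~ odd n -> #|e| = 2 ->
  exists s, exists u, exists2 D : edge_set n, #|D| <= 3 &
    forall B : edge_set n, D :&: (edges n :\ e) \subset B ->
      safe s u [set e] (edges n :\ e :\: B).
Proof.
move=> n4 evn /eqP ce; have /cards2P[a [b [ab eE]]] := ce.
have [s [sK sn sa]] := exists_involution evn ab.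
have [u ue] : exists u, u \notin e.
  apply/existsP; rewrite -negb_forall; apply: contraTN n4 => /forallP all.
  by rewrite -ltnNge -[n]card_ord -cardsT (eq_card (B := e)) ?(eqP ce) // => x;
     rewrite inE all.
exists s, u, [set [set u; s u]; [set u; a]; [set u; b]].
  by rewrite (leq_trans (leq_card_setU _ _)) // cards1 cards2; case: eqP.
move=> B /subsetP sB.
have uve : [set u; s u] != e by apply: contraNneq ue => <-; rewrite set21.
apply/safeP; split=> //.
  rewrite in_setU1 negb_or uve /= !inE; apply/negP=> /and3P[/negP nB _ cuv].
  by apply: nB; apply: sB; rewrite !inE eqxx uve.
move=> e' f /set1P-> /setU1P[->|]; first exact: conflict_irr.
rewrite !inE => /and3P[/negP nB fe cf]; apply/negP=> C; apply: nB; apply: sB.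
move: C; rewrite eE -sa => /(conflict_matched sK).
by rewrite sa !inE -eE fe cf !andbT -orbA => ->; rewrite orbT.
Qed.

End Invariant.

Theorem theorem4p1 (n : nat) (hn : 4 <= n) (hev : ~~ odd n) :
  clique_game_won_by_player2 1 3 n.
Proof.
have edges0 : edges n != set0.
  pose i : 'I_n := Ordinal (leq_trans (isT : 0 < 4) hn).
  pose j : 'I_n := Ordinal (leq_trans (isT : 1 < 4) hn).
  by apply/set0Pn; exists [set i; j]; rewrite inE cards2.
(* The initial position is a separate case, as [s] and [u] are chosen only after the first red
   edge. *)
pose I (R U : edge_set n) := (R == set0) && (U == edges n) ||
  [exists s : {ffun 'I_n -> 'I_n}, exists u, safe s u R U].
have IS s u R U : safe s u R U -> I R U.
  by move=> H; apply/orP; right; apply/existsP; exists s; apply/existsP; exists u.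
apply: (@player2_wins_by_invariant 1 3 n I); first by rewrite /I !eqxx.
  move=> R U M UE IRU sM cM.
  case: (set_0Vmem U) => [U0|[x xU]].
    have M0 : M = set0 by apply/eqP; rewrite -subset0 -U0.
    by exists set0; rewrite M0 U0 !setD0 setU0 cards0 sub0set -U0.
  have [e eM] : exists e, M = [set e].
    by apply/cards1P; rewrite cM (minn_idPl _) //; apply/card_gt0P; exists x.
  have eU : e \in U by rewrite (subsetP sM) // eM set11.
  have e2 : #|e| = 2 by move: (subsetP UE e eU); rewrite inE => /eqP.
  have [s [u [D D3 Dsafe]]] : exists s, exists u, exists2 D : edge_set n, #|D| <= 3 &
      forall B : edge_set n, D :&: (U :\ e) \subset B ->
        safe s u (e |: R) (U :\ e :\: B).
    case/orP: IRU => [/andP[/eqP-> /eqP->]|/existsP[s /existsP[u H]]].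
      by rewrite setU0; exact: safe_first.
    exists s, u; exact: safe_step H eU e2.
  have [|B [sDB sB] cB] := @exists_set_between _ (D :&: (U :\ e)) (U :\ e)
      (minn 3 #|U :\ e|) (subsetIr _ _).
    rewrite geq_minr andbT leq_min (leq_trans (subset_leq_card (subsetIl _ _)) D3).
    exact: subset_leq_card (subsetIr _ _).
  exists B; rewrite eM; split=> //; rewrite setUC; exact: IS (Dsafe B sDB).
move=> R /orP[/andP[_ /eqP E]|/existsP[s /existsP[u /safeP[sK sn uv indep]]]].
  by rewrite -E eqxx in edges0.
rewrite setU0 in uv indep; exact: (@clique_number_conflict_free n s u).
Qed.
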